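(* Assume the hypotheses (H1)–(H6) listed in the context. Let $(s^0_{\alpha,K})_{K\in\mathcal{T}}\in[0,1]$ for $\alpha=l,g$, let $\mathcal{D}$ be a finite volume discretization of $\Omega\times(0,T)$, and assume that $(p_{\alpha,\mathcal{D}})$, $\alpha=l,g$, is a solution of the finite volume scheme described in the context. Then the saturations $(s^n_{\alpha,K})_{K\in\mathcal{T},\,n\in\{0,\dots,N\}}$ remain in $[0,1]$.
   Context: **Data and assumptions.** $T>0$; $\Omega$ is a bounded open subset of $\mathbb{R}^\ell$ ($\ell\ge1$); $Q_T=(0,T)\times\Omega$; $\partial\Omega=\Gamma_l\cup\Gamma_{imp}$; $\mathbf{g}$ is the gravity vector; the permeability tensor is the identity. The phases are $\alpha\in\{l,g\}$, with pressures $p_\alpha$ and saturations $s_\alpha$, $s_l+s_g=1$, and capillary law $p_c(s_l)=p_g-p_l$. Boundary conditions of the problem: $p_l=p_g=0$ on $(0,T)\times\Gamma_l$, and zero normal flux of each phase on $(0,T)\times\Gamma_{imp}$. Initial data: pressures $p^0_\alpha\in L^2(\Omega)$ and saturations $s^0_\alpha$ with $0\le s^0_\alpha\le1$ a.e. in $\Omega$. $f_I$, $f_P$ are the injection and production terms, and $s^I_\alpha$ are the known saturations (volume fractions) of the injected fluid. (H1) There are positive constants $\phi_0,\phi_1$ with $\phi_0\le\phi(x)\le\phi_1$ a.e. in $\Omega$ ($\phi$ is the porosity). (H2) The mobilities $M_l,M_g$ belong to $C^0([0,1],\mathbb{R}^+)$, $M_\alpha(0)=0$, and there is $m_0>0$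 with $M_l(s_l)+M_g(s_g)\ge m_0$ for all $s_l\in[0,1]$, $s_g=1-s_l$. They are non-decreasing, and are extended outside $[0,1]$ by continuous constant functions. (H3) $f_P,f_I\in L^2(Q_T)$, $f_P,f_I\ge0$ a.e. in $Q_T$. (H4) The densities $\rho_\alpha\in C^1(\mathbb{R})$ are increasing, and there are constants $\rho_m,\rho_M>0$ with $0<\rho_m\le\rho_\alpha(p_\alpha)\le\rho_M$. (H5) $p_c\in C^1([0,1];\mathbb{R}^+)$ is decreasing and there is $\underline{p_c}>0$ with $0<\underline{p_c}\le|p_c'|$. (H6) With $M(s)=M_l(s)+M_g(1-s)$, the function $\gamma(s)=-\frac{M_l(s)M_g(1-s)}{M(s)}p_c'(s)$ belongs to $C^1([0,1];\mathbb{R}^+)$, $\gamma>0$ on $(0,1)$, $\gamma(0)=\gamma(1)=0$; with $\mathcal{B}(s)=\int_0^s\gamma(z)\,dz$, the inverse $\mathcal{B}^{-1}$ is Hölder of order $\theta$, $0<\theta\le1$, on $[0,\mathcal{B}(1)]$. **Discretization.** An admissible mesh $\mathcal{T}$ of $\Omega$ is a set of disjoint open bounded polygonal convex control volumes $K$, the closure of whose union is $\overline\Omega$, with centers $x_K\in K$. $\mathcal{E}$ is the set of pairs $(K,L)\in\mathcal{T}^2$, $K\ne L$, such that $\sigma_{K|L}=\overline K\cap\overline L$ has positive $(\ell-1)$-dimensional measure $|\sigma_{K|L}|$; $N(K)=\{L\in\mathcal{T}:(K,L)\in\mathcal{E}\}$; $\partial K=(\overline K\cap\partial\Omega)\cup\bigcup_{L\in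 N(K)}\sigma_{K|L}$; for $L\in N(K)$ the line through $x_K,x_L$ is orthogonal to $\sigma_{K|L}$; $d_{K|L}$ is the distance between $x_K$ and $x_L$; $\tau_{K|L}=|\sigma_{K|L}|/d_{K|L}$; $\eta_{K|L}$ is the unit normal to $\sigma_{K|L}$ outward to $K$; $|K|$ is the measure of $K$. Regularity: for a given $\xi>0$, $\sum_{L\in N(K)}|\sigma_{K|L}|d_{K|L}\le\xi|K|$ for all $K\in\mathcal{T}$. Time grid: an integer $N$ and $t^0=0<t^1<\dots<t^{N+1}=T$ with uniform step $\delta t$. A discretization $\mathcal{D}$ consists of an admissible mesh and a time grid. **Scheme.** $\delta^{n+1}_{K|L}(u)=u^{n+1}_L-u^{n+1}_K$; $c^+=\max(c,0)$, $c^-=\max(-c,0)$; $G_\alpha(a,b,c)=-M_\alpha(b)c^++M_\alpha(a)c^-$. $\phi_K$ is the mean of $\phi$ on $K$; $f^{n+1}_{P,K},f^{n+1}_{I,K},(s^I_{\alpha,K})^{n+1}$ are the means of $f_P,f_I,s^I_\alpha$ over $(t^n,t^{n+1})\times K$. The interface density is given by $\frac1{\rho^{n+1}_{\alpha,K|L}}=\frac{1}{p^{n+1}_{\alpha,L}-p^{n+1}_{\alpha,K}}\int_{p^{n+1}_{\alpha,K}}^{p^{n+1}_{\alpha,L}}\frac{d\zeta}{\rho_\alpha(\zeta)}$ if $p^{n+1}_{\alpha,K}\ne p^{n+1}_{\alpha,L}$, and $1/\rho_\alpha(p^{n+1}_{\alpha,K})$ otherwise. Gravity flux: $F^{n+1}_{\alpha,K}=\sum_{L\in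 N(K)}|\sigma_{K|L}|(\rho^{n+1}_{\alpha,K|L})^2\big(M_\alpha(s^{n+1}_{\alpha,K})(\mathbf{g}\cdot\eta_{K|L})^+-M_\alpha(s^{n+1}_{\alpha,L})(\mathbf{g}\cdot\eta_{K|L})^-\big)$. The scheme is: $p^0_{\alpha,K},s^0_{\alpha,K}$ are the means of $p^0_\alpha,s^0_\alpha$ on $K$, and for all $K\in\mathcal{T}$, $n=0,\dots,N$, $\alpha=l,g$, $$|K|\phi_K\frac{\rho_\alpha(p^{n+1}_{\alpha,K})s^{n+1}_{\alpha,K}-\rho_\alpha(p^n_{\alpha,K})s^n_{\alpha,K}}{\delta t}+\sum_{L\in N(K)}\tau_{K|L}\rho^{n+1}_{\alpha,K|L}G_\alpha(s^{n+1}_{\alpha,K},s^{n+1}_{\alpha,L};\delta^{n+1}_{K|L}(p_\alpha))+F^{n+1}_{\alpha,K}$$ $$+|K|\rho_\alpha(p^{n+1}_{\alpha,K})s^{n+1}_{\alpha,K}f^{n+1}_{P,K}=|K|\rho_\alpha(p^{n+1}_{\alpha,K})(s^I_{\alpha,K})^{n+1}f^{n+1}_{I,K},$$ $$s^{n+1}_{l,K}+s^{n+1}_{g,K}=1,\qquad p_c(s^{n+1}_{l,K})=p^{n+1}_{g,K}-p^{n+1}_{l,K}.$$ The discrete unknowns corresponding to $p_\alpha$ and $s_\alpha$ are $p_{\alpha,\mathcal{D}}=(p^{n+1}_{\alpha,K})_{K,n}$ and $s_{\alpha,\mathcal{D}}=(s^{n+1}_{\alpha,K})_{K,n}$. *)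

(* Defs.v *)
From HB Require Import structures.
From mathcomp Require Import all_boot all_order all_algebra.
From mathcomp Require Import all_classical all_reals all_analysis.
Set Implicit Arguments.
Unset Strict Implicit.
Unset Printing Implicit Defensive.
Import Order.TTheory GRing.Theory Num.Theory.
Import numFieldNormedType.Exports.
Local Open Scope classical_set_scope.
Local Open Scope ring_scope.

(* The library has Lebesgue measure on R only; on 'rV[R]_n it is built here as
   the n-fold product measure, over the sigma-algebra generated by the
   coordinates (the Borel sets of R^n). [lebesgue_rV_box] fixes its value on
   boxes. *)
Definition rV_display : measure_display. Proof. exact: default_measure_display. Qed.

Section measurable_rV.
Variables (R : realType) (n : nat).

Let coord (i : 'I_n) (v : 'rV[R]_n) : measurableTypeR R := v ord0 i.
Definition rV_measurable := g_sigma_preimage coord.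

Let m0 : rV_measurable set0. Proof. exact: sigma_algebra0. Qed.
Let mC A : rV_measurable A -> rV_measurable (~` A).
Proof. exact: sigma_algebraC. Qed.
Let mU (F : (set 'rV[R]_n)^nat) : (forall i, rV_measurable (F i)) ->
  rV_measurable (\bigcup_i F i).
Proof. exact: sigma_algebra_bigcup. Qed.

HB.instance Definition _ := @isMeasurable.Build rV_display 'rV[R]_n
  rV_measurable m0 mC mU.

Lemma measurable_coord (i : 'I_n) :
  measurable_fun [set: 'rV[R]_n] (fun v => v ord0 i : measurableTypeR R).
Proof.
move=> _ Y mY; rewrite setTI; apply: sub_sigma_algebra => /=.
rewrite -bigcup_seq/=; exists i => /=; first by rewrite mem_index_enum.
by exists Y => //; rewrite setTI.
Qed.

Lemma measurable_fun_rVP d (T : measurableType d) (f : T -> 'rV[R]_n) :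
  (forall i, measurable_fun [set: T] (fun x => f x ord0 i : measurableTypeR R)) ->
  measurable_fun [set: T] f.
Proof.
move=> mf _ A mA; rewrite setTI.
suff : preimage_set_system setT f rV_measurable `<=` measurable.
  by apply; exists A => //; rewrite setTI.
rewrite /rV_measurable -g_sigma_preimage_comp.
apply: smallest_sub; first exact: sigma_algebra_measurable.
move=> B; rewrite -bigcup_seq/= => -[i _] [C mC' <-].
exact: mf.
Qed.
End measurable_rV.

Section lebesgue_rV.
Variable R : realType.

Definition rV_cons n (p : measurableTypeR R * 'rV[R]_n) : 'rV[R]_n.+1 :=
  row_mx (const_mx p.1 : 'rV[R]_1) p.2.

Lemma rV_cons0 n p : @rV_cons n p ord0 ord0 = p.1.
Proof.
rewrite /rV_cons (_ : ord0 = lshift n (ord0 : 'I_1)); last exact/val_inj.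
by rewrite [LHS](row_mxEl (const_mx p.1 : 'rV[R]_1) p.2) mxE.
Qed.

Lemma rV_cons_lift n p (j : 'I_n) : rV_cons p ord0 (lift ord0 j) = p.2 ord0 j.
Proof.
rewrite /rV_cons (_ : lift ord0 j = rshift 1 j); last exact/val_inj.
by rewrite [LHS](row_mxEr (const_mx p.1 : 'rV[R]_1) p.2).
Qed.

Lemma measurable_rV_cons n : measurable_fun setT (@rV_cons n).
Proof.
apply: measurable_fun_rVP => i; case: (unliftP ord0 i) => [j|] ->.
- under eq_fun do rewrite rV_cons_lift.
  exact: (measurableT_comp (measurable_coord j) measurable_snd).
- under eq_fun do rewrite rV_cons0.
  exact: measurable_fst.
Qed.

Definition rV_uncons n (v : 'rV[R]_n.+1) : measurableTypeR R * 'rV[R]_n :=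
  (v ord0 ord0, \row_j v ord0 (lift ord0 j)).

Lemma rV_consK n : cancel (@rV_cons n) (@rV_uncons n).
Proof.
move=> [x v]; rewrite /rV_uncons rV_cons0; congr pair.
by apply/rowP => j; rewrite mxE rV_cons_lift.
Qed.

Lemma rV_unconsK n : cancel (@rV_uncons n) (@rV_cons n).
Proof.
move=> v; apply/rowP => i; case: (unliftP ord0 i) => [j|] ->.
- by rewrite rV_cons_lift mxE.
- by rewrite rV_cons0.
Qed.

Lemma measurable_rV_uncons n : measurable_fun setT (@rV_uncons n).
Proof.
apply: measurable_fun_pair; first exact: measurable_coord.
apply: measurable_fun_rVP => i; under eq_fun do rewrite mxE.
exact: measurable_coord.
Qed.

Section step.
Variables (n : nat) (mu : {sigma_finite_measure set 'rV[R]_n -> \bar R}).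

Definition rV_prod : set 'rV[R]_n.+1 -> \bar R :=
  pushforward (@lebesgue_measure R \x mu)%E (@rV_cons n).

HB.instance Definition _ := Measure.copy rV_prod
  (measure_function_pushforward__canonical__measure_function_Measure
    (@lebesgue_measure R \x mu)%E (@measurable_rV_cons n)).

Let rV_prod_sigma_finite : sigma_finite setT rV_prod.
Proof.
have /sigma_finiteP[F [TF ndF Foo]] := sigma_finiteT (@lebesgue_measure R).
have /sigma_finiteP[G [TG ndG Goo]] := sigma_finiteT mu.
exists (fun k => @rV_uncons n @^-1` (F k `*` G k)).
  rewrite -preimage_bigcup (_ : \bigcup_k _ = setT) ?preimage_setT//.
  rewrite -setXTT TF TG predeqE => -[x y]; split.
    by move=> [k _ []/= ? ?]; split; exists k.
  move=> [/= [k _ Fkx] [j _ Gjy]]; exists (maxn k j) => //; split.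
  - by move: x Fkx; exact/subsetPset/ndF/leq_maxl.
  - by move: y Gjy; exact/subsetPset/ndG/leq_maxr.
move=> k; have [mF Fk] := Foo k; have [mG Gk] := Goo k; split.
  by rewrite -[X in measurable X]setTI; apply: measurable_rV_uncons => //;
    exact: measurableX.
rewrite /rV_prod /pushforward -comp_preimage (_ : _ @^-1` _ = F k `*` G k); last first.
  by apply/seteqP; split=> p; rewrite /preimage /mkset /comp rV_consK.
by rewrite product_measure1E// lte_mul_pinfty// ge0_fin_numE.
Qed.

HB.instance Definition _ := Measure_isSigmaFinite.Build _ _ _ rV_prod
  rV_prod_sigma_finite.
End step.

Fixpoint lebesgue_rV n : {sigma_finite_measure set 'rV[R]_n -> \bar R} :=
  match n with
  | 0 => \d_(0 : 'rV[R]_0)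
  | m.+1 => rV_prod (lebesgue_rV m)
  end.

Lemma lebesgue_rV_box n (a b : 'rV[R]_n) : (forall i, a ord0 i <= b ord0 i) ->
  lebesgue_rV n [set v : 'rV[R]_n | forall i, v ord0 i \in `[a ord0 i, b ord0 i]] =
  (\prod_i (b ord0 i - a ord0 i))%:E.
Proof.
elim: n a b => [a b _|n IH a b ab].
  rewrite big_ord0 /= diracE mem_set//= => -[]//.
rewrite /= /rV_prod /pushforward big_ord_recl.
pose a' := \row_j a ord0 (lift ord0 j); pose b' := \row_j b ord0 (lift ord0 j).
rewrite (_ : _ @^-1` _ = `[a ord0 ord0, b ord0 ord0]%classic `*`
  [set v : 'rV[R]_n | forall i, v ord0 i \in `[a' ord0 i, b' ord0 i]]); last first.
  apply/seteqP; split=> -[x v] /=.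
  - move=> H; split; first by have := H ord0; rewrite rV_cons0.
    by move=> i; have := H (lift ord0 i); rewrite rV_cons_lift !mxE.
  - move=> [Hx Hv] i; case: (unliftP ord0 i) => [j|] ->.
    + by rewrite rV_cons_lift; have := Hv j; rewrite !mxE.
    + by rewrite rV_cons0.
rewrite product_measure1E//=; last first.
  rewrite (_ : mkset _ = \bigcap_(i in [set: 'I_n])
     (fun v : 'rV[R]_n => v ord0 i) @^-1` `[a' ord0 i, b' ord0 i]%classic).
    apply: fin_bigcap_measurable => // i _; rewrite -[X in measurable X]setTI.
    exact: measurable_coord.
  by apply/seteqP; split=> v /= H i; [move=> _; exact: H|exact: (H i I)].
rewrite lebesgue_measure_itv/= lte_fin EFinM IH; last by move=> i; rewrite !mxE.
congr (_ * _)%E; last first.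
  by congr EFin; apply: eq_bigr => i _; rewrite !mxE.
have := ab ord0; rewrite le_eqVlt => /orP[/eqP ->|->//].
by rewrite ltxx subrr.
Qed.
End lebesgue_rV.

Section euclidean.
Variables (R : realType) (n : nat).
Implicit Types (u v : 'rV[R]_n) (S : set 'rV[R]_n).

Definition dotv u v : R := (u *m v^T) ord0 ord0.

(* The library norm on 'rV[R]_n is the sup norm, hence this one. *)
Definition euclid_norm u : R := Num.sqrt (dotv u u).

Definition orthogonal_to v S :=
  forall y z, S y -> S z -> dotv v (y - z) = 0.

Definition outward_unit_normal (K S : set 'rV[R]_n) v :=
  [/\ euclid_norm v = 1, orthogonal_to v S &
      forall x y, K x -> S y -> dotv v (x - y) < 0].

(* A finite intersection of open half-spaces is open, convex and polygonal. *)
Definition open_convex_polytope S :=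
  bounded_set S /\
  exists H : seq ('rV[R]_n * R)%type,
    S = [set x | forall h, h \in H -> dotv h.1 x < h.2].

End euclidean.

Definition frontier (T : topologicalType) (A : set T) : set T :=
  closure A `\` A°.

(* d-dimensional measure of a subset S of a hyperplane of R^(d+1). The maps
   t |-> c + t *m B with B *m B^T = 1 are the isometric embeddings of R^d:
   those onto the hyperplane of S pull S back to a set whose Lebesgue measure is
   |S|; the others pull S back into a proper affine subspace, of measure 0.
   For d = 0 this is the counting measure of a set with at most one point. *)
Definition hyperplane_measure (R : realType) (d : nat) (S : set 'rV[R]_d.+1) :
    \bar R :=
  ereal_sup [set a | exists (c : 'rV[R]_d.+1) (B : 'M[R]_(d, d.+1)),
    B *m B^T = 1%:M /\ a = lebesgue_rV R d [set t | S (c + t *m B)]].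

Section calculus.
Variable R : realType.
Implicit Types (f : R -> R) (A : set R).

(* Derivative relative to A: on A = `[0, 1] it is one-sided at 0 and 1, and at
   points of A it does not depend on f outside A. *)
Definition diff_quot f (x y : R) : R := (f y - f x) / (y - x).

Definition derive_within A f (x : R) : R :=
  lim (diff_quot f x @ within A x^').

Definition C1_on A f :=
  (forall x, A x -> cvg (diff_quot f x @ within A x^')) /\
  {within A, continuous (derive_within A f)}.

Definition oriented_integral f (a b : R) : R :=
  if a <= b then \int[lebesgue_measure]_(z in `[a, b]) f z
  else - \int[lebesgue_measure]_(z in `[b, a]) f z.

Definition pos_part (c : R) : R := Num.max c 0.
Definition neg_part (c : R) : R := Num.max (- c) 0.

Definition square_integrable d (T : measurableType d)
    (mu : {measure set T -> \bar R}) (A : set T) (f : T -> R) :=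
  measurable_fun A f /\ mu.-integrable A (fun x => (f x ^+ 2)%:E).

Definition average d (T : measurableType d) (mu : {measure set T -> \bar R})
    (A : set T) (f : T -> R) : R :=
  (\int[mu]_(x in A) f x) / fine (mu A).

End calculus.

Definition lebesgue_spacetime (R : realType) (n : nat) :
    {measure set (measurableTypeR R * 'rV[R]_n) -> \bar R} :=
  (@lebesgue_measure R \x lebesgue_rV R n)%E.

Variant phase := liquid | gas.

(* Data of the continuous problem in space dimension d + 1. The mobilities
   are given together with their extension outside [0, 1]; the capillary
   pressure carries an arbitrary extension outside [0, 1], on which nothing is
   assumed. *)
Record problem (R : realType) (d : nat) := Problem {
  final_time : R;
  domain : set 'rV[R]_d.+1;
  bdry_l : set 'rV[R]_d.+1;
  bdry_imp : set 'rV[R]_d.+1;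
  gravity : 'rV[R]_d.+1;
  porosity : 'rV[R]_d.+1 -> R;
  mobility : phase -> R -> R;
  density : phase -> R -> R;
  cap_pressure : R -> R;
  production : measurableTypeR R * 'rV[R]_d.+1 -> R;
  injection : measurableTypeR R * 'rV[R]_d.+1 -> R;
  injected_sat : phase -> measurableTypeR R * 'rV[R]_d.+1 -> R;
  init_pressure : phase -> 'rV[R]_d.+1 -> R;
  init_sat : phase -> 'rV[R]_d.+1 -> R
}.

Section hypotheses.
Variables (R : realType) (d : nat) (P : problem R d).

Local Notation leb := (lebesgue_rV R d.+1).
Local Notation lebQ := (lebesgue_spacetime R d.+1).
Local Notation Omega := (domain P).

Definition QT : set (measurableTypeR R * 'rV[R]_d.+1) :=
  `]0, final_time P[%classic `*` Omega.

Record standing_assumptions : Prop := {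
  final_time_gt0 : 0 < final_time P;
  domain_open : open Omega;
  domain_bounded : bounded_set Omega;
  domain_frontier : frontier Omega = bdry_l P `|` bdry_imp P;
  init_pressureL2 : forall a, square_integrable leb Omega (init_pressure P a);
  init_sat_meas : forall a, measurable_fun Omega (init_sat P a);
  init_sat01 : forall a,
    {ae leb, forall x, Omega x -> 0 <= init_sat P a x <= 1};
  injected_sat_meas : forall a, measurable_fun QT (injected_sat P a);
  injected_sat01 : forall a,
    {ae lebQ, forall z, QT z -> 0 <= injected_sat P a z <= 1}
}.

Definition H1 := measurable_fun Omega (porosity P) /\
  exists phi0 phi1 : R, [/\ 0 < phi0, 0 < phi1 &
    {ae leb, forall x, Omega x -> phi0 <= porosity P x <= phi1}].

Record mobility_assumptions (M : R -> R) : Prop := {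
  mob_cont : {within `[0, 1], continuous M};
  mob_ge0 : {in `[0, 1], forall s, 0 <= M s};
  mob0 : M 0 = 0;
  mob_nondecreasing : {in `[0, 1] &, {homo M : s t / s <= t}};
  mob_extl : forall s, s <= 0 -> M s = M 0;
  mob_extr : forall s, 1 <= s -> M s = M 1
}.

Definition total_mobility (s : R) : R :=
  mobility P liquid s + mobility P gas (1 - s).

Definition H2 := (forall a, mobility_assumptions (mobility P a)) /\
  exists2 m0 : R, 0 < m0 & {in `[0, 1], forall s, m0 <= total_mobility s}.

Definition source_assumption (f : measurableTypeR R * 'rV[R]_d.+1 -> R) :=
  square_integrable lebQ QT f /\ {ae lebQ, forall z, QT z -> 0 <= f z}.

Definition H3 :=
  source_assumption (production P) /\ source_assumption (injection P).

Definition H4 :=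
  (forall a x, derivable (density P a) x 1) /\
  (forall a, continuous (derive1 (density P a))) /\
  (forall a, {homo density P a : x y / x < y}) /\
  exists rhom rhoM : R, [/\ 0 < rhom, 0 < rhoM &
    forall a x, rhom <= density P a x <= rhoM].

Definition cap_pressure' : R -> R :=
  derive_within `[0, 1] (cap_pressure P).

Definition H5 :=
  [/\ C1_on `[0, 1] (cap_pressure P),
      {in `[0, 1], forall s, 0 <= cap_pressure P s},
      {in `[0, 1] &, {homo cap_pressure P : s t /~ s < t}} &
      exists2 c : R, 0 < c & {in `[0, 1], forall s, c <= `|cap_pressure' s|}].

Definition gamma (s : R) : R :=
  - (mobility P liquid s * mobility P gas (1 - s) / total_mobility s)
  * cap_pressure' s.

Definition beta (s : R) : R := \int[lebesgue_measure]_(z in `[0, s]) gamma z.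

Definition H6 :=
  [/\ C1_on `[0, 1] gamma,
      {in `[0, 1], forall s, 0 <= gamma s},
      {in `]0, 1[, forall s, 0 < gamma s},
      gamma 0 = 0 /\ gamma 1 = 0 &
      exists (beta_inv : R -> R) (theta C : R),
        [/\ {in `[0, 1], cancel beta beta_inv},
            {in `[0, beta 1], cancel beta_inv beta},
            0 < theta <= 1 &
            {in `[0, beta 1] &, forall u v,
               `|beta_inv u - beta_inv v| <= C * `|u - v| `^ theta}]].

End hypotheses.

(* face_normal K L and cell_center K are constrained by [admissible_mesh]
   below; face_normal K L only for neighbouring K and L. *)
Record mesh (R : realType) (d : nat) := Mesh {
  cell : finType;
  cv : cell -> set 'rV[R]_d.+1;
  cell_center : cell -> 'rV[R]_d.+1;
  face_normal : cell -> cell -> 'rV[R]_d.+1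
}.

Section mesh_theory.
Variables (R : realType) (d : nat) (m : mesh R d).
Implicit Types K L : cell m.

Definition face K L : set 'rV[R]_d.+1 := closure (cv K) `&` closure (cv L).

Definition neighbour K L : bool :=
  (K != L) && (0 < hyperplane_measure (face K L))%E.

Definition volume K : R := fine (lebesgue_rV R d.+1 (cv K)).
Definition face_area K L : R := fine (hyperplane_measure (face K L)).
Definition center_dist K L : R := euclid_norm (cell_center L - cell_center K).
Definition transmissibility K L : R := face_area K L / center_dist K L.

Record admissible_mesh (Omega : set 'rV[R]_d.+1) (xi : R) : Prop := {
  cv_sub : forall K, cv K `<=` Omega;
  cv_polytope : forall K, open_convex_polytope (cv K);
  cv_disjoint : forall K L, K != L -> cv K `&` cv L = set0;
  cv_cover : closure (\bigcup_(K in [set: cell m]) cv K) = closure Omega;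
  center_in : forall K, cv K (cell_center K);
  cv_frontier : forall K, frontier (cv K) =
    (closure (cv K) `&` frontier Omega)
    `|` \bigcup_(L in [set L | neighbour K L]) face K L;
  center_orthogonal : forall K L, neighbour K L ->
    orthogonal_to (cell_center L - cell_center K) (face K L);
  normal_outward : forall K L, neighbour K L ->
    outward_unit_normal (cv K) (face K L) (face_normal K L);
  mesh_regular : forall K,
    \sum_(L | neighbour K L) face_area K L * center_dist K L <= xi * volume K
}.

End mesh_theory.

Section scheme.
Variables (R : realType) (d : nat) (P : problem R d) (m : mesh R d) (N : nat).
Implicit Types (K L : cell m) (a : phase).

(* The uniform grid with t^0 = 0 and t^(N+1) = T. *)
Definition time_step : R := final_time P / N.+1%:R.
Definition time (n : nat) : R := n%:R * time_step.

Definition cell_mean (f : 'rV[R]_d.+1 -> R) K : R :=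
  average (lebesgue_rV R d.+1) (cv K) f.

(* mean over (t^n, t^(n+1)) x K *)
Definition slab_mean (f : measurableTypeR R * 'rV[R]_d.+1 -> R) n K : R :=
  average (lebesgue_spacetime R d.+1)
    (`]time n, time n.+1[%classic `*` cv K) f.

Definition num_flux a (x y c : R) : R :=
  - mobility P a y * pos_part c + mobility P a x * neg_part c.

Definition face_density a (x y : R) : R :=
  (if x == y then (density P a x)^-1
   else (y - x)^-1 * oriented_integral (fun z => (density P a z)^-1) x y)^-1.

(* The unknowns are indexed by the time level: p a n K and s a n K are the
   pressure and saturation of phase a at t^n in K. *)
Variables p s : phase -> nat -> cell m -> R.

Definition gravity_flux a n K : R :=
  \sum_(L | neighbour K L)
    face_area K L * face_density a (p a n K) (p a n L) ^+ 2
    * (mobility P a (s a n K) * pos_part (dotv (gravity P) (face_normal K L))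
       - mobility P a (s a n L) * neg_part (dotv (gravity P) (face_normal K L))).

Definition mass_balance a n K : Prop :=
  volume K * cell_mean (porosity P) K
    * ((density P a (p a n.+1 K) * s a n.+1 K
        - density P a (p a n K) * s a n K) / time_step)
  + \sum_(L | neighbour K L)
      transmissibility K L * face_density a (p a n.+1 K) (p a n.+1 L)
      * num_flux a (s a n.+1 K) (s a n.+1 L) (p a n.+1 L - p a n.+1 K)
  + gravity_flux a n.+1 K
  + volume K * density P a (p a n.+1 K) * s a n.+1 K
      * slab_mean (production P) n K
  = volume K * density P a (p a n.+1 K)
      * slab_mean (injected_sat P a) n K * slab_mean (injection P) n K.

Record scheme_solution : Prop := {
  sol_init_pressure : forall a K, p a 0%N K = cell_mean (init_pressure P a) K;
  sol_init_sat : forall a K, s a 0%N K = cell_mean (init_sat P a) K;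
  sol_balance : forall a n K, (n <= N)%N -> mass_balance a n K;
  sol_sat : forall n K, (n <= N)%N -> s liquid n.+1 K + s gas n.+1 K = 1;
  sol_cap : forall n K, (n <= N)%N ->
    cap_pressure P (s liquid n.+1 K) = p gas n.+1 K - p liquid n.+1 K
}.

End scheme.

(* Main.v *)
Require Import Defs.
From HB Require Import structures.
From mathcomp Require Import all_boot all_order all_algebra.
From mathcomp Require Import all_classical all_reals all_analysis.
From mathcomp Require Import measurable_realfun.
Import Order.TTheory GRing.Theory Num.Theory.
Import numFieldNormedType.Exports.
Local Open Scope classical_set_scope.
Local Open Scope ring_scope.

(** The argument looks at one cell over one time step.
Suppose that at the new time level the saturation of a phase in a cell [K] is
negative.  The mobility vanishes on the negative reals, so nothing flows out of
[K]: in the upwind flux and in the gravity flux only the terms that carry the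
mobility of the neighbours survive, and they all describe inflow, which is
nonpositive in the balance of [K] ([num_flux_le0], [gravity_flux_le0]).  The
production term is nonpositive like the saturation, and the injection term on the
right is nonnegative.  Hence the accumulation term is nonnegative, whereas the
old saturation is nonnegative and the new one negative, so that this term is
negative ([mass_balance_sat_ge0]).  Induction on the time level gives
nonnegativity of both saturations, and since they add up to 1 both are at
most 1.

The strict sign of the accumulation term requires the coefficient
[volume K * cell_mean (porosity P) K] to be positive, and the signs of the
source terms have to be read off hypotheses that hold almost everywhere.  This is
the measure-theoretic part: open sets of ['rV[R]_n] are measurable for the
sigma-algebra generated by the coordinates ([open_rV_measurable]), a nonempty
bounded open set has positive finite Lebesgue measure ([lebesgue_rV_open_gt0],
[lebesgue_rV_bounded_fin]), and almost-everywhere bounds pass to integrals. *)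

(** * Open sets and Lebesgue measure on row vectors *)

Section open_rV.
Context {R : realType} {n : nat}.
Implicit Types (x : 'rV[R]_n) (U : set 'rV[R]_n).

Definition rV_box (a b : 'rV[R]_n) : set 'rV[R]_n :=
  [set v | forall i, v ord0 i \in `[a ord0 i, b ord0 i]].

Definition rat_box (q : 'rV[rat]_n * 'rV[rat]_n) : set 'rV[R]_n :=
  rV_box (map_mx ratr q.1) (map_mx ratr q.2).

Lemma measurable_rV_box (a b : 'rV[R]_n) : measurable (rV_box a b).
Proof.
rewrite (_ : rV_box a b = \bigcap_(i in [set: 'I_n])
   (fun v : 'rV[R]_n => v ord0 i) @^-1` `[a ord0 i, b ord0 i]%classic).
  apply: fin_bigcap_measurable => // i _; rewrite -[X in measurable X]setTI.
  exact: measurable_coord.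
by apply/seteqP; split=> v /= H i; [move=> _; exact: H|exact: (H i I)].
Qed.

(** The topology of ['rV[R]_n] is that of the sup norm, so a ball is a box and
its corners can be moved to rational points.  Rational corners serve the
countability used below, strict inclusion of [x] the positivity of the
volume. *)
Lemma open_rat_box {U x} : open U -> U x ->
  exists q : 'rV[rat]_n * 'rV[rat]_n,
    [/\ forall i, ratr (q.1 ord0 i) < x ord0 i < ratr (q.2 ord0 i) &
        rat_box q `<=` U].
Proof.
move=> oU Ux; have /nbhs_ballP[e /= e0 xeU] := open_nbhs_nbhs (conj oU Ux).
have /choice[a aP] (i : 'I_n) : exists q : rat,
    ratr q \in `](x ord0 i - e), (x ord0 i)[.
  by apply: rat_in_itvoo; rewrite ltrBlDr ltrDl.
have /choice[b bP] (i : 'I_n) : exists q : rat,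
    ratr q \in `](x ord0 i), (x ord0 i + e)[.
  by apply: rat_in_itvoo; rewrite ltrDl.
exists (\row_i a i, \row_i b i); split=> [i|v vab].
  by rewrite !mxE; move: (aP i) (bP i); rewrite !in_itv/= => /andP[_ ->] /andP[].
apply: xeU; split=> // k i; rewrite (ord1 k).
move: (vab i) (aP i) (bP i); rewrite /= !mxE !in_itv/=.
move=> /andP[av vb] /andP[xa _] /andP[_ bx].
by rewrite /ball/= ltr_distlC (lt_le_trans xa av) (le_lt_trans vb bx).
Qed.

Lemma open_rV_measurable {U} : open U -> measurable U.
Proof.
move=> oU; pose F q := if `[< rat_box q `<=` U >] then rat_box q else set0.
have -> : U = \bigcup_q F q.
  apply/seteqP; split=> [x Ux|x [q _]]; last first.
    by rewrite /F; case: ifP => // /asboolP; exact.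
  have [q [xq qU]] := open_rat_box oU Ux; exists q => //.
  rewrite /F; case: ifP => [_|/asboolP//] i; rewrite in_itv/= !mxE.
  by have /andP[/ltW -> /ltW ->] := xq i.
apply: countable_bigcupT_measurable => [|q]; first exact: countableP.
by rewrite /F; case: ifP => // _; exact: measurable_rV_box.
Qed.

Lemma lebesgue_rV_open_gt0 {U} : open U -> U !=set0 ->
  (0 < lebesgue_rV R n U)%E.
Proof.
move=> oU [x Ux]; have [q [xq qU]] := open_rat_box oU Ux.
have lt_q i : ratr (q.1 ord0 i) < ratr (q.2 ord0 i) :> R.
  by have /andP[] := xq i; exact: lt_trans.
apply: (@lt_le_trans _ _ (lebesgue_rV R n (rat_box q))); last first.
  by apply: le_measure; rewrite ?inE//;
    [exact: measurable_rV_box|exact: open_rV_measurable].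
rewrite lebesgue_rV_box; last by move=> i; rewrite !mxE ltW.
by rewrite lte_fin prodr_gt0// => i _; rewrite !mxE subr_gt0.
Qed.

Lemma lebesgue_rV_bounded_fin {U} : measurable U -> bounded_set U ->
  (lebesgue_rV R n U < +oo)%E.
Proof.
move=> mU [M [_ MU]]; pose r := Num.max (M + 1) 0.
have UM x : U x -> `|x| <= r.
  by move=> Ux; apply: MU => //; rewrite lt_max ltrDl ltr01.
pose a : 'rV[R]_n := const_mx (- r); pose b : 'rV[R]_n := const_mx r.
apply: (@le_lt_trans _ _ (lebesgue_rV R n (rV_box a b))).
  apply: le_measure; rewrite ?inE//; first exact: measurable_rV_box.
  move=> x /UM xr i; rewrite in_itv/= !mxE -ler_norml; apply: le_trans xr.
  rewrite [leRHS]/Num.Def.normr/= mx_normrE; apply/bigmax_geP; right => /=.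
  by exists (ord0, i).
rewrite lebesgue_rV_box ?ltry// => i; rewrite !mxE.
by rewrite ge0_cp// le_max lexx orbT.
Qed.

End open_rV.

Section polytope.
Context {R : realType} {n : nat}.

Lemma dotv_continuous (h : 'rV[R]_n) : continuous (dotv h).
Proof.
rewrite (_ : dotv h = fun v => \sum_i h ord0 i * v ord0 i); last first.
  by apply/funext => v; rewrite /dotv mxE; apply: eq_bigr => i _; rewrite mxE.
apply: continuous_big => [|i _ v]; first exact: add_continuous.
have ? : Filter (nbhs v) by exact: nbhs_filter.
have c1 : (fun=> h ord0 i) @ nbhs v --> h ord0 i by exact: cvg_cst.
exact: cvgM c1 (@coord_continuous _ _ _ _ _ v).
Qed.

Lemma open_convex_polytope_open (S : set 'rV[R]_n) :
  open_convex_polytope S -> open S.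
Proof.
move=> [_ [H ->]].
rewrite (_ : mkset _ =
  \bigcap_(h in [set` H]) (dotv h.1 @^-1` [set y | y < h.2])).
  rewrite bigcap_seq; apply: big_ind => [|A B|h _]; [exact: openT|exact: openI|].
  apply: open_comp; last exact: open_lt.
  by move=> v _; exact: dotv_continuous.
by apply/seteqP; split=> v /= vH h hH; exact: vH.
Qed.

End polytope.

(** * Integrals of functions bounded almost everywhere *)

Section ae_bounds.
Context {d} {T : measurableType d} {R : realType}.
Context {mu : {measure set T -> \bar R}} {D : set T}.
Hypothesis mD : measurable D.
Implicit Types f : T -> R.

Lemma Rintegral_ae_ge0 {f} : measurable_fun D f ->
  {ae mu, forall x, D x -> 0 <= f x} -> 0 <= \int[mu]_(x in D) f x.
Proof.
move=> mf f0; rewrite /Rintegral.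
rewrite (@ae_eq_integral _ _ _ mu D (fun x => (Num.max (f x) 0)%:E))//.
- by rewrite fine_ge0// integral_ge0// => x _; rewrite lee_fin le_max lexx orbT.
- exact/measurable_EFinP.
- by apply/measurable_EFinP; apply: measurable_maxr => //; exact: measurable_cst.
- by apply: filterS f0 => x f0 /f0 fx; congr EFin; apply/esym/max_idPl.
Qed.

(** The upper bound and the finiteness of [mu D] keep the extended integral
finite: the real-valued integral is 0 by convention when the extended one is
infinite. *)
Lemma Rintegral_ae_gt0 {f} {c C : R} : measurable_fun D f ->
  (0 < mu D)%E -> (mu D < +oo)%E -> 0 < c ->
  {ae mu, forall x, D x -> c <= f x <= C} -> 0 < \int[mu]_(x in D) f x.
Proof.
move=> mf D0 Doo c0 fcC.
(* The truncation of f to [c, max C c] agrees with f almost everywhere, and its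
   bounds hold everywhere. *)
pose g x := Num.min (Num.max (f x) c) (Num.max C c).
have cg x : c <= g x by rewrite /g le_min !le_max lexx !orbT.
have gC x : g x <= Num.max C c by rewrite /g ge_min lexx orbT.
have mg : measurable_fun D (EFin \o g).
  apply/measurable_EFinP; apply: measurable_minr => //.
  by apply: measurable_maxr.
have g0 x : 0 <= g x by exact: le_trans (ltW c0) (cg x).
rewrite /Rintegral (@ae_eq_integral _ _ _ mu D (EFin \o g))//; last 2 first.
- exact/measurable_EFinP.
- apply: filterS fcC => x fcC /fcC/andP[cf fC]; congr EFin; rewrite /g.
  by rewrite (max_idPl cf) (max_idPl (le_trans cf fC)) (min_idPl fC).
apply: fine_gt0; apply/andP; split.
- apply: (@lt_le_trans _ _ (\int[mu]_(x in D) cst c%:E x)%E).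
    by rewrite integral_cst// mule_gt0.
  by apply: ge0_le_integral => // x _; rewrite ?lee_fin// ltW.
- apply: (@le_lt_trans _ _ (\int[mu]_(x in D) cst (Num.max C c)%:E x)%E).
    apply: ge0_le_integral => // x _; rewrite ?lee_fin//.
  by rewrite integral_cst// lte_mul_pinfty// lee_fin le_max (ltW c0) orbT.
Qed.

Lemma average_ae_ge0 {f} : measurable_fun D f ->
  {ae mu, forall x, D x -> 0 <= f x} -> 0 <= average mu D f.
Proof.
by move=> mf f0; apply: divr_ge0; [exact: Rintegral_ae_ge0|exact: fine_ge0].
Qed.

Lemma average_ae_gt0 {f} {c C : R} : measurable_fun D f ->
  (0 < mu D)%E -> (mu D < +oo)%E -> 0 < c ->
  {ae mu, forall x, D x -> c <= f x <= C} -> 0 < average mu D f.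
Proof.
move=> mf D0 Doo c0 fcC; apply: divr_gt0; last exact/fine_gt0/andP.
exact: Rintegral_ae_gt0 fcC.
Qed.

End ae_bounds.

(** * Signs of the terms of the scheme *)

Section fluxes.
Context {R : realType} {d : nat}.
Context {P : problem R d}.
Implicit Types (a : phase) (x y c : R).

Lemma pos_part_ge0 c : 0 <= pos_part c.
Proof. by rewrite le_max lexx orbT. Qed.

Lemma neg_part_ge0 c : 0 <= neg_part c.
Proof. by rewrite le_max lexx orbT. Qed.

Lemma mobility_ge0 {a} x : mobility_assumptions (mobility P a) ->
  0 <= mobility P a x.
Proof.
move=> M; have [x0|x0] := leP x 0; first by rewrite (mob_extl M x0) (mob0 M).
have [x1|x1] := leP x 1; last first.
  by rewrite (mob_extr M (ltW x1)) (mob_ge0 M)// in_itv/= ler01 lexx.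
by rewrite (mob_ge0 M)// in_itv/= (ltW x0) x1.
Qed.

Lemma mobility_le0_eq0 {a x} : mobility_assumptions (mobility P a) ->
  x <= 0 -> mobility P a x = 0.
Proof. by move=> M x0; rewrite (mob_extl M x0) (mob0 M). Qed.

(** Upwinding: the outgoing part of the flux carries the mobility of the cell
itself, which vanishes, so that only inflow is left. *)
Lemma num_flux_le0 {a x} y c : mobility_assumptions (mobility P a) ->
  x <= 0 -> num_flux P a x y c <= 0.
Proof.
move=> M x0; rewrite /num_flux (mobility_le0_eq0 M x0) mul0r addr0 mulNr oppr_le0.
by rewrite mulr_ge0 ?pos_part_ge0// mobility_ge0.
Qed.

(** The quotient of the integral by the increment keeps its sign when the
endpoints are exchanged, both factors being odd. *)
Lemma face_density_ge0 a x y : (forall z, 0 <= density P a z) ->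
  0 <= face_density P a x y.
Proof.
move=> r0; rewrite /face_density; case: ifP => _; first by rewrite !invr_ge0.
have I0 u v : 0 <= \int[lebesgue_measure]_(z in `[u, v]) (density P a z)^-1.
  by apply: Rintegral_ge0 => z _; rewrite invr_ge0.
rewrite invr_ge0 /oriented_integral; case: (leP x y) => xy.
  by rewrite mulr_ge0 ?invr_ge0 ?subr_ge0.
by rewrite mulrN -mulNr mulr_ge0// oppr_ge0 invr_le0 subr_le0 ltW.
Qed.

End fluxes.

Section mesh_signs.
Context {R : realType} {d : nat}.
Context {m : mesh R d}.
Implicit Types K L : cell m.

Lemma face_area_ge0 {K L} : neighbour K L -> 0 <= face_area K L.
Proof. by case/andP => _ h; rewrite /face_area fine_ge0// ltW. Qed.

Lemma transmissibility_ge0 {K L} : neighbour K L -> 0 <= transmissibility K L.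
Proof.
by move=> KL; apply: divr_ge0; [exact: face_area_ge0|exact: sqrtr_ge0].
Qed.

Context {Omega : set 'rV[R]_d.+1} {xi : R}.
Hypothesis hm : admissible_mesh m Omega xi.

Lemma cv_open K : open (cv K).
Proof. exact/open_convex_polytope_open/(cv_polytope hm). Qed.

Lemma cv_measurable K : measurable (cv K).
Proof. exact: open_rV_measurable (cv_open K). Qed.

Lemma cv_measure_gt0 K : (0 < lebesgue_rV R d.+1 (cv K))%E.
Proof.
apply: (lebesgue_rV_open_gt0 (cv_open K)).
by exists (cell_center K); exact: (center_in hm).
Qed.

Lemma cv_measure_fin K : (lebesgue_rV R d.+1 (cv K) < +oo)%E.
Proof.
apply: (lebesgue_rV_bounded_fin (cv_measurable K)).
by have [] := cv_polytope hm K.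
Qed.

Lemma volume_gt0 K : 0 < volume K.
Proof. by apply: fine_gt0; rewrite cv_measure_gt0 cv_measure_fin. Qed.

End mesh_signs.

Section means.
Context {R : realType} {d : nat}.
Context {P : problem R d} {m : mesh R d} {N : nat} {xi : R}.
Hypothesis hP : standing_assumptions P.
Hypothesis hm : admissible_mesh m (domain P) xi.
Implicit Types (K : cell m) (n : nat).

Lemma time_step_gt0 : 0 < time_step P N.
Proof. by rewrite divr_gt0// (final_time_gt0 hP). Qed.

Lemma porosity_mean_gt0 K : H1 P -> 0 < cell_mean (porosity P) K.
Proof.
move=> [mphi [phi0 [phi1 [phi0_gt0 _ phiB]]]].
have KO : cv K `<=` domain P by exact: (cv_sub hm).
apply: (@average_ae_gt0 _ _ _ _ _ (cv_measurable hm K) _ phi0 phi1) => //.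
- apply: measurable_funS mphi => //.
  exact: open_rV_measurable (domain_open hP).
- exact: cv_measure_gt0 hm K.
- exact: cv_measure_fin hm K.
- by apply: filterS phiB => x phiB /KO.
Qed.

Lemma QT_measurable : measurable (QT P).
Proof.
by apply: measurableX => //; exact: open_rV_measurable (domain_open hP).
Qed.

Lemma slab_sub_QT {n} K : (n <= N)%N ->
  `]time P N n, time P N n.+1[%classic `*` cv K `<=` QT P.
Proof.
move=> nN [t x] [/= tn Kx]; split => /=; last exact: cv_sub hm _ _ Kx.
move: tn; rewrite !in_itv/= => /andP[nt tn]; apply/andP; split.
  by apply: le_lt_trans nt; rewrite mulr_ge0// ltW// time_step_gt0.
apply: (lt_le_trans tn).
rewrite /time /time_step mulrCA ger_pMr ?(final_time_gt0 hP)//.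
by rewrite ler_pdivrMr// mul1r ler_nat.
Qed.

Lemma slab_mean_ge0 {f : measurableTypeR R * 'rV[R]_d.+1 -> R} {n} K :
  (n <= N)%N -> measurable_fun (QT P) f ->
  {ae lebesgue_spacetime R d.+1, forall z, QT P z -> 0 <= f z} ->
  0 <= slab_mean P N f n K.
Proof.
move=> nN mf f0; have sub := slab_sub_QT K nN.
apply: average_ae_ge0.
- by apply: measurableX => //; exact: cv_measurable hm K.
- exact: measurable_funS QT_measurable sub mf.
- by apply: filterS f0 => z f0 /sub.
Qed.

End means.

(** * Nonnegativity of the saturations *)

Section nonnegativity.
Context {R : realType} {d : nat}.
Context {P : problem R d} {m : mesh R d} {N : nat} {xi : R}.
Context {p s : phase -> nat -> cell m -> R}.
Hypotheses (hP : standing_assumptions P) (hm : admissible_mesh m (domain P) xi).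
Hypotheses (h1 : H1 P) (h2 : H2 P) (h3 : H3 P).
Hypothesis rho_gt0 : forall a x, 0 < density P a x.
Implicit Types (a : phase) (n : nat) (K : cell m).

Lemma gravity_flux_le0 {a n K} : s a n K <= 0 -> gravity_flux P p s a n K <= 0.
Proof.
move=> s0; have [M _] := h2; apply: sumr_le0 => L KL.
rewrite (mobility_le0_eq0 (M a) s0) mul0r sub0r mulrN oppr_le0.
apply: mulr_ge0; apply: mulr_ge0.
- exact: face_area_ge0.
- exact: sqr_ge0.
- exact: mobility_ge0 (M a).
- exact: neg_part_ge0.
Qed.

(** If the new saturation were negative, every term of the left side would be
nonpositive and the accumulation term negative, against a nonnegative
injection term. *)
Lemma mass_balance_sat_ge0 {a n K} : (n <= N)%N -> 0 <= s a n K ->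
  mass_balance P N p s a n K -> 0 <= s a n.+1 K.
Proof.
move=> nN sn0; rewrite /mass_balance; set acc := _ * (_ / _).
set flux := \sum_(L | _) _; set grav := gravity_flux _ _ _ _ _ _.
set prod := _ * slab_mean _ _ (production P) _ _; set inj := (RHS).
move=> balance; rewrite leNgt; apply/negP => s_lt0.
have [[[mfP _] fP0] [[mfI _] fI0]] := h3; have [M _] := h2.
have vol_gt0 := volume_gt0 hm K.
have rhos_lt0 : density P a (p a n.+1 K) * s a n.+1 K < 0 by rewrite pmulr_rlt0.
have acc_lt0 : acc < 0.
  rewrite /acc pmulr_rlt0; last by rewrite mulr_gt0// (porosity_mean_gt0 hP hm).
  rewrite pmulr_llt0 ?invr_gt0 ?(time_step_gt0 hP)// subr_lt0.
  by rewrite (lt_le_trans rhos_lt0)// mulr_ge0// ltW.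
have flux_le0 : flux <= 0.
  apply: sumr_le0 => L KL; apply: mulr_ge0_le0; last first.
    exact: num_flux_le0 (M a) (ltW s_lt0).
  rewrite mulr_ge0 ?transmissibility_ge0// face_density_ge0// => z.
  exact: ltW.
have grav_le0 : grav <= 0 by exact/gravity_flux_le0/ltW.
have prod_le0 : prod <= 0.
  rewrite /prod -(mulrA (volume K)) mulr_le0_ge0//.
    by rewrite mulr_ge0_le0 ?ltW.
  exact: (slab_mean_ge0 hP hm K nN mfP fP0).
have inj_ge0 : 0 <= inj.
  apply: mulr_ge0; last exact: (slab_mean_ge0 hP hm K nN mfI fI0).
  apply: mulr_ge0; first by rewrite ltW// mulr_gt0.
  apply: (slab_mean_ge0 hP hm K nN (injected_sat_meas hP a)).
  by apply: filterS (injected_sat01 hP a) => z H /H/andP[].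
move: inj_ge0; rewrite -balance leNgt => /negP; apply.
by do 3!apply: ltr_wnDr => //.
Qed.

End nonnegativity.

Theorem lemma6 (R : realType) (d N : nat) (xi : R)
    (P : problem R d) (m : mesh R d) (p s : phase -> nat -> cell m -> R)
    (xi_gt0 : 0 < xi) (hP : standing_assumptions P)
    (h1 : H1 P) (h2 : H2 P) (h3 : H3 P) (h4 : H4 P) (h5 : H5 P) (h6 : H6 P)
    (s0_01 : forall (a : phase) (K : cell m), 0 <= s a 0%N K <= 1)
    (hm : admissible_mesh m (domain P) xi)
    (hsol : scheme_solution P N p s) :
  forall (a : phase) (n : nat) (K : cell m),
    (n <= N)%N -> 0 <= s a n K <= 1.
Proof.
have rho_gt0 a x : 0 < density P a x.
  have [_ [_ [_ [rm [rM [rm0 _ rB]]]]]] := h4.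
  by have /andP[rx _] := rB a x; exact: lt_le_trans rx.
have s_ge0 n : (n <= N)%N -> forall a K, 0 <= s a n K.
  elim: n => [_ a K|n IH nN a K]; first by have /andP[] := s0_01 a K.
  exact: (mass_balance_sat_ge0 hP hm h1 h2 h3 rho_gt0 (ltnW nN)
            (IH (ltnW nN) a K) (sol_balance hsol a K (ltnW nN))).
move=> a [|n] K nN; first exact: s0_01.
rewrite s_ge0//= -(sol_sat hsol K (ltnW nN)).
by case: a; rewrite ?lerDl ?lerDr s_ge0.
Qed.
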